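(* Let $(\mathcal{E},\circ)$ be a Euclidean Jordan algebra of rank $r$, with cone of squares $\mathcal{K}$, let $\mathcal{E}=\mathcal{E}_1\oplus\cdots\oplus\mathcal{E}_\ell$ be its decomposition into simple Euclidean Jordan algebras (blocks), and let $\lambda\in\mathcal{E}$. The following statements are equivalent: (i) $\lambda\in\mathcal{K}$. (ii) There exists $y\in\mathcal{E}$ such that $y\circ\lambda=0$ and $\langle w\circ w,\lambda\rangle>0$ for every $w\in\mathcal{E}$ satisfying $y\circ w=0$ and $w\neq 0$. Moreover, any $y$ satisfying the condition in (ii) is such that (a) $\operatorname{rank} y=r-\operatorname{rank}\lambda$; (b) if $\sigma$ and $\sigma'$ are nonzero eigenvalues of $y$ belonging to the same block (i.e. both are eigenvalues of the component $y_i\in\mathcal{E}_i$ of $y$ for the same $i$), then $\sigma+\sigma'\neq 0$.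
   Context: A Euclidean Jordan algebra is a finite-dimensional real inner product space $\mathcal{E}$ with a bilinear product $\circ$ and a unit element $e$ such that for all $y,z,w$: $y\circ z=z\circ y$; $y\circ(y^2\circ z)=y^2\circ(y\circ z)$ with $y^2=y\circ y$; $\langle y\circ z,w\rangle=\langle y,z\circ w\rangle$. An idempotent is $c$ with $c\circ c=c$; it is primitive if it is nonzero and is not a sum $a+b$ of nonzero idempotents with $a\circ b=0$. Every $y\in\mathcal{E}$ has a spectral decomposition $y=\sum_{i=1}^r\sigma_ic_i$ with $\sigma_i\in\mathbb{R}$ (the eigenvalues of $y$, unique up to order, with multiplicity) and primitive idempotents $c_1,\dots,c_r$ with $c_i\circ c_j=0$ for $i\ne j$ and $c_1+\cdots+c_r=e$ (a Jordan frame). The number $r$ depends only on $\mathcal{E}$ and is its rank. The rank of $y$ is the number of nonzero eigenvalues, $\operatorname{tr}(y)=\sum_i\sigma_i$, and it is assumed that $\langle x,y\rangle=\operatorname{tr}(x\circ y)$. The cone of squares is $\mathcal{K}=\{y\circ y\mid y\in\mathcal{E}\}$. An algebra is simple if it is not a direct sum of two nonzero subalgebras (direct sum of algebras, so that products of elements of different summands vanish). Every Euclidean Jordan algebra is an orthogonal direct sum $\mathcal{E}=\mathcal{E}_1\oplus\cdots\oplus\mathcal{E}_\ell$ of simple Euclidean Jordan algebras with $\mathcal{E}_i\circ\mathcal{E}_j=\{0\}$ for $i\neq j$. Each $y$ is written $y=y_1+\cdots+y_\ell$ with $y_i\in\mathcal{E}_i$; the eigenvalues of $y$ belonging to block $i$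 are the eigenvalues of $y_i$ in $\mathcal{E}_i$, counted with multiplicity. *)

(* Defs.v *)
From HB Require Import structures.
From mathcomp Require Import all_boot all_order all_algebra.
From mathcomp Require Import boolp classical_sets reals.

Set Implicit Arguments.
Unset Strict Implicit.
Unset Printing Implicit Defensive.

Import Order.TTheory GRing.Theory Num.Theory.

Local Open Scope ring_scope.
Local Open Scope classical_set_scope.

Declare Scope jordan_scope.
Delimit Scope jordan_scope with J.

(* Linearity in the second argument of [jmul] and [jip] follows from
   commutativity and symmetry. *)
HB.mixin Record Vector_isEuclideanJordan (R : realType) E of Vector R E := {
  jmul : E -> E -> E;
  jone : E;
  jip : E -> E -> R;
  jmulC : forall x y, jmul x y = jmul y x;
  jmul_linearl : forall a x y z, jmul (a *: x + y) z = a *: jmul x z + jmul y z;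
  jmul1l : forall x, jmul jone x = x;
  jmul_jordan : forall y z,
    jmul y (jmul (jmul y y) z) = jmul (jmul y y) (jmul y z);
  jipC : forall x y, jip x y = jip y x;
  jip_linearl : forall a x y z, jip (a *: x + y) z = a * jip x z + jip y z;
  jip_gt0 : forall x, x != 0 -> 0 < jip x x;
  jip_jmul : forall y z w, jip (jmul y z) w = jip y (jmul z w)
}.

#[short(type="ejaType")]
HB.structure Definition EuclideanJordan (R : realType) :=
  { E of Vector R E & Vector_isEuclideanJordan R E }.

Notation "x ∘ y" := (jmul x y) (at level 40, left associativity) : jordan_scope.
Notation "'⟨' x , y '⟩'" := (jip x y)
  (at level 0, x at level 200, y at level 200, format "'⟨' x ,  y '⟩'")
  : jordan_scope.
Local Open Scope jordan_scope.

Definition cone_of_squares (R : realType) (E : ejaType R) : set E :=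
  [set y ∘ y | y in [set: E]].
Arguments cone_of_squares {R} E _.

Definition jidempotent (R : realType) (E : ejaType R) (c : E) : Prop :=
  c ∘ c = c.

Definition jprimitive (R : realType) (E : ejaType R) (c : E) : Prop :=
  [/\ jidempotent c, c != 0 &
      ~ exists a b : E, [/\ jidempotent a /\ a != 0, jidempotent b /\ b != 0,
                            a ∘ b = 0 & c = a + b]].

Definition jordan_frame (R : realType) (E : ejaType R) (r : nat)
    (c : 'I_r -> E) : Prop :=
  [/\ forall i, jprimitive (c i),
      forall i j, i != j -> c i ∘ c j = 0 &
      \sum_(i < r) c i = jone].

(* All Jordan frames of [E] have the same size, so any choice gives the rank. *)
Definition jalg_rank (R : realType) (E : ejaType R) : nat :=
  xget 0%N [set r | exists c : 'I_r -> E, jordan_frame c].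

Definition spectrum_of (R : realType) (E : ejaType R) (y : E) (s : seq R)
    : Prop :=
  exists2 c : 'I_(size s) -> E,
    jordan_frame c & y = \sum_(i < size s) s`_i *: c i.

(* Such a list is unique up to permutation, so that choosing one is harmless. *)
Definition jeigenvalues (R : realType) (E : ejaType R) (y : E) : seq R :=
  xget [::] [set s | spectrum_of y s].

Definition jrank (R : realType) (E : ejaType R) (y : E) : nat :=
  count (fun s => s != 0) (jeigenvalues y).

Definition jtrace (R : realType) (E : ejaType R) (y : E) : R :=
  \sum_(s <- jeigenvalues y) s.

Definition trace_inner_product (R : realType) (E : ejaType R) : Prop :=
  forall x y : E, ⟨x, y⟩ = jtrace (x ∘ y).

Definition jsubalgebra (R : realType) (E : ejaType R) (U : {vspace E}) : Prop :=
  forall x y, x \in U -> y \in U -> x ∘ y \in U.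

Definition jsimple (R : realType) (E : ejaType R) : Prop :=
  ~ exists U V : {vspace E},
      [/\ jsubalgebra U /\ U != 0%VS, jsubalgebra V /\ V != 0%VS,
          (U + V)%VS = fullv, (U :&: V)%VS = 0%VS &
          forall x y, x \in U -> y \in V -> x ∘ y = 0].

(* A subalgebra with a unit of its own, which need not be [jone]. *)
Record ejsub (R : realType) (E : ejaType R) := EJSub {
  ejsub_vs :> {vspace E};
  ejsub_one : E;
  ejsub_mul : jsubalgebra ejsub_vs;
  ejsub_one_mem : ejsub_one \in ejsub_vs;
  ejsub_mul1 : forall x, x \in ejsub_vs -> ejsub_one ∘ x = x
}.

(* The elements of [U], as a Euclidean Jordan algebra in its own right, with
   the product and inner product of [E]. *)
Definition ejsub_type (R : realType) (E : ejaType R) (U : ejsub E) : Type :=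
  subvs_of U.

HB.instance Definition _ (R : realType) (E : ejaType R) (U : ejsub E) :=
  Vector.copy (ejsub_type U) (subvs_of U).

Definition ejsub_jmul (R : realType) (E : ejaType R) (U : ejsub E)
    (x y : ejsub_type U) : ejsub_type U :=
  Subvs (ejsub_mul (subvsP x) (subvsP y)).

Definition ejsub_jone (R : realType) (E : ejaType R) (U : ejsub E)
    : ejsub_type U :=
  Subvs (ejsub_one_mem U).

Definition ejsub_jip (R : realType) (E : ejaType R) (U : ejsub E)
    (x y : ejsub_type U) : R :=
  ⟨vsval x, vsval y⟩.

Lemma ejsub_jmulC (R : realType) (E : ejaType R) (U : ejsub E)
  (x y : ejsub_type U) : ejsub_jmul x y = ejsub_jmul y x.
Proof. by apply: val_inj; exact: jmulC. Qed.

Lemma ejsub_jmul_linearl (R : realType) (E : ejaType R) (U : ejsub E)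
    (a : R) (x y z : ejsub_type U) :
  ejsub_jmul (a *: x + y) z = a *: ejsub_jmul x z + ejsub_jmul y z.
Proof. by apply: val_inj; exact: jmul_linearl. Qed.

Lemma ejsub_jmul1l (R : realType) (E : ejaType R) (U : ejsub E)
  (x : ejsub_type U) : ejsub_jmul (ejsub_jone U) x = x.
Proof. by apply: val_inj; apply: ejsub_mul1; exact: subvsP. Qed.

Lemma ejsub_jmul_jordan (R : realType) (E : ejaType R) (U : ejsub E)
    (y z : ejsub_type U) :
  ejsub_jmul y (ejsub_jmul (ejsub_jmul y y) z) =
  ejsub_jmul (ejsub_jmul y y) (ejsub_jmul y z).
Proof. by apply: val_inj; exact: jmul_jordan. Qed.

Lemma ejsub_jipC (R : realType) (E : ejaType R) (U : ejsub E)
  (x y : ejsub_type U) : ejsub_jip x y = ejsub_jip y x.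
Proof. exact: jipC. Qed.

Lemma ejsub_jip_linearl (R : realType) (E : ejaType R) (U : ejsub E)
    (a : R) (x y z : ejsub_type U) :
  ejsub_jip (a *: x + y) z = a * ejsub_jip x z + ejsub_jip y z.
Proof. exact: jip_linearl. Qed.

Lemma ejsub_jip_gt0 (R : realType) (E : ejaType R) (U : ejsub E)
  (x : ejsub_type U) : x != 0 -> 0 < ejsub_jip x x.
Proof. by move=> x0; apply: jip_gt0; apply: contra_neq x0 => x0; apply: val_inj. Qed.

Lemma ejsub_jip_jmul (R : realType) (E : ejaType R) (U : ejsub E)
    (y z w : ejsub_type U) :
  ejsub_jip (ejsub_jmul y z) w = ejsub_jip y (ejsub_jmul z w).
Proof. exact: jip_jmul. Qed.

HB.instance Definition _ (R : realType) (E : ejaType R) (U : ejsub E) :=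
  Vector_isEuclideanJordan.Build R (ejsub_type U)
    (@ejsub_jmulC R E U) (@ejsub_jmul_linearl R E U) (@ejsub_jmul1l R E U)
    (@ejsub_jmul_jordan R E U) (@ejsub_jipC R E U) (@ejsub_jip_linearl R E U)
    (@ejsub_jip_gt0 R E U) (@ejsub_jip_jmul R E U).

Definition simple_decomposition (R : realType) (E : ejaType R) (l : nat)
    (B : 'I_l -> ejsub E) : Prop :=
  [/\ (\sum_(i < l) (B i : {vspace E}))%VS = fullv,
      directv (\sum_(i < l) (B i : {vspace E}))%VS,
      forall i j, i != j -> forall x y, x \in ejsub_vs (B i) ->
        y \in ejsub_vs (B j) -> ⟨x, y⟩ = 0 /\ x ∘ y = 0 &
      forall i, jsimple (ejsub_type (B i))].

Definition strict_complement (R : realType) (E : ejaType R) (lambda y : E)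
    : Prop :=
  y ∘ lambda = 0 /\
  forall w : E, y ∘ w = 0 -> w != 0 -> 0 < ⟨w ∘ w, lambda⟩.

(* Main.v *)
From HB Require Import structures.
Require Import Defs.
From mathcomp Require Import all_boot all_order all_algebra.
From mathcomp Require Import boolp classical_sets reals.
From mathcomp Require Import complex ring lra.

(* Diagonalize y = sum_i u_i c_i along a Jordan frame. The Peirce component
   v = 4 c_i (c_j lambda) of lambda satisfies both y v = 0 and
   y v = (u_i + u_j)/2 v. If u_i <> 0 and v <> 0, then u_j = - u_i <> 0; since
   v o v is a combination of c_i and c_j, both orthogonal to lambda, strictness
   fails at w = v. Hence c_i lambda = 0 as soon as u_i <> 0. Consequently the
   supports p of y and q of lambda are orthogonal, and jone - (p + q) is an
   idempotent annihilated by y and by lambda, hence 0 by strictness; ranks are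
   traces of supports, which gives (a). Strictness at the idempotents of a frame
   diagonalizing lambda makes the nonzero eigenvalues of lambda positive. For (b),
   in a simple block any two members of a Jordan frame are linked by a nonzero w
   in their common Peirce 1/2-space; if their eigenvalues under y were opposite
   and nonzero, then y w = 0 and <w o w, lambda> = 0, contradicting strictness. *)

Set Implicit Arguments.
Unset Strict Implicit.
Unset Printing Implicit Defensive.

Import Order.TTheory GRing.Theory Num.Theory.

Local Open Scope ring_scope.
Local Open Scope jordan_scope.

(** * Bilinearity of the product and of the inner product *)

Section Bilinearity.
Variables (R : realType) (E : ejaType R).
Implicit Types (a : R) (x y z w : E).

Lemma jmulDl x y z : (x + y) ∘ z = x ∘ z + y ∘ z.
Proof. by have := jmul_linearl 1 x y z; rewrite !scale1r. Qed.

Lemma jmul0l z : 0 ∘ z = 0 :> E.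
Proof. by apply/(addrI (0 ∘ z)); rewrite -jmulDl !addr0. Qed.

Lemma jmulZl a x z : (a *: x) ∘ z = a *: (x ∘ z).
Proof. by have := jmul_linearl a x 0 z; rewrite jmul0l !addr0. Qed.

Lemma jmulNl x z : (- x) ∘ z = - (x ∘ z).
Proof. by rewrite -scaleN1r jmulZl scaleN1r. Qed.

Lemma jmulDr x y z : z ∘ (x + y) = z ∘ x + z ∘ y.
Proof. by rewrite ![z ∘ _]jmulC jmulDl. Qed.

Lemma jmul0r z : z ∘ 0 = 0 :> E.
Proof. by rewrite jmulC jmul0l. Qed.

Lemma jmulZr a x z : z ∘ (a *: x) = a *: (z ∘ x).
Proof. by rewrite ![z ∘ _]jmulC jmulZl. Qed.

Lemma jmulNr x z : z ∘ (- x) = - (z ∘ x).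
Proof. by rewrite ![z ∘ _]jmulC jmulNl. Qed.

Lemma jmul_suml (I : Type) (r : seq I) (P : pred I) (F : I -> E) z :
  (\sum_(i <- r | P i) F i) ∘ z = \sum_(i <- r | P i) F i ∘ z.
Proof. exact: (big_morph (fun x => x ∘ z) (fun x y => jmulDl x y z) (jmul0l z)). Qed.

Lemma jmul_sumr (I : Type) (r : seq I) (P : pred I) (F : I -> E) z :
  z ∘ (\sum_(i <- r | P i) F i) = \sum_(i <- r | P i) z ∘ F i.
Proof. by rewrite jmulC jmul_suml; apply: eq_bigr => i _; rewrite jmulC. Qed.

Lemma jmul1r x : x ∘ jone = x.
Proof. by rewrite jmulC jmul1l. Qed.

Lemma jipDl x y z : ⟨x + y, z⟩ = ⟨x, z⟩ + ⟨y, z⟩.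
Proof. by have := jip_linearl 1 x y z; rewrite scale1r mul1r. Qed.

Lemma jip0l z : ⟨0, z⟩ = 0 :> R.
Proof. by apply/(addrI ⟨0, z⟩); rewrite -jipDl !addr0. Qed.

Lemma jipZl a x z : ⟨a *: x, z⟩ = a * ⟨x, z⟩.
Proof. by have := jip_linearl a x 0 z; rewrite jip0l !addr0. Qed.

Lemma jipNl x z : ⟨- x, z⟩ = - ⟨x, z⟩.
Proof. by rewrite -scaleN1r jipZl mulN1r. Qed.

Lemma jip_suml (I : Type) (r : seq I) (P : pred I) (F : I -> E) z :
  ⟨\sum_(i <- r | P i) F i, z⟩ = \sum_(i <- r | P i) ⟨F i, z⟩.
Proof. exact: (big_morph (fun x => ⟨x, z⟩) (fun x y => jipDl x y z) (jip0l z)). Qed.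

Lemma jipDr x y z : ⟨z, x + y⟩ = ⟨z, x⟩ + ⟨z, y⟩.
Proof. by rewrite ![⟨z, _⟩]jipC jipDl. Qed.

Lemma jip0r z : ⟨z, 0⟩ = 0 :> R.
Proof. by rewrite jipC jip0l. Qed.

Lemma jipZr a x z : ⟨z, a *: x⟩ = a * ⟨z, x⟩.
Proof. by rewrite ![⟨z, _⟩]jipC jipZl. Qed.

Lemma jipNr x z : ⟨z, - x⟩ = - ⟨z, x⟩.
Proof. by rewrite ![⟨z, _⟩]jipC jipNl. Qed.

Lemma jip_sumr (I : Type) (r : seq I) (P : pred I) (F : I -> E) z :
  ⟨z, \sum_(i <- r | P i) F i⟩ = \sum_(i <- r | P i) ⟨z, F i⟩.
Proof. by rewrite jipC jip_suml; apply: eq_bigr => i _; rewrite jipC. Qed.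

Lemma jip_jmulr x y z : ⟨x, y ∘ z⟩ = ⟨x ∘ y, z⟩.
Proof. by rewrite jip_jmul. Qed.

Lemma jip_ge0 x : 0 <= ⟨x, x⟩.
Proof.
have [->|x0] := eqVneq x 0; first by rewrite jip0l.
exact/ltW/jip_gt0.
Qed.

Lemma jip_eq0 x : (⟨x, x⟩ == 0) = (x == 0).
Proof.
have [->|x0] := eqVneq x 0; first by rewrite jip0l eqxx.
by rewrite gt_eqF// jip_gt0.
Qed.

Lemma jip_ext x y : (forall z, ⟨x, z⟩ = ⟨y, z⟩) -> x = y.
Proof.
move=> h; apply/eqP; rewrite -subr_eq0 -jip_eq0.
by rewrite jipDl jipNl h subrr.
Qed.

End Bilinearity.

Definition jlinE (R : realType) (E : ejaType R) :=
  (@jmulDl R E, @jmulDr R E, @jmulZl R E, @jmulZr R E, @jmulNl R E, @jmulNr R E,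
   @jmul0l R E, @jmul0r R E, @jmul1l R E, @jmul1r R E).
Definition jipE (R : realType) (E : ejaType R) :=
  (@jipDl R E, @jipZl R E, @jipNl R E, @jip0l R E).
(* A linear identity between vectors is proved by pairing it with an arbitrary
   vector, which turns it into linear arithmetic over the scalars. *)
Ltac jlin :=
  intros; apply: jip_ext; let u := fresh "u" in intro u;
  repeat match goal with H : _ = _ |- _ =>
    apply (congr1 (fun t => jip t u)) in H; rewrite ?jipE in H end;
  rewrite ?jipE; lra.

(** * Linearized Jordan identities and Peirce calculus of an idempotent *)

Section Peirce.
Variables (R : realType) (E : ejaType R).
Implicit Types (a : R) (x y z w c d : E).

(** The part of the Jordan identity that is linear in [y]: half the difference of its instances at
    [x + y] and [x - y], minus the instance at [y]. *)
Lemma jordan2 x y z :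
  2 *: (x ∘ ((x ∘ y) ∘ z)) + y ∘ ((x ∘ x) ∘ z) =
  2 *: ((x ∘ y) ∘ (x ∘ z)) + (x ∘ x) ∘ (y ∘ z).
Proof.
have := jmul_jordan (x - y) z; have := jmul_jordan (x + y) z.
have := jmul_jordan y z.
rewrite !jlinE [y ∘ x]jmulC => h1 h2 h3.
by jlin.
Qed.

(** Full polarization: [jordan2] at [x + w], minus its instances at [x] and at [w]. *)
Lemma jordan3 x y w z :
  x ∘ ((y ∘ w) ∘ z) + y ∘ ((w ∘ x) ∘ z) + w ∘ ((x ∘ y) ∘ z) =
  (y ∘ w) ∘ (x ∘ z) + (w ∘ x) ∘ (y ∘ z) + (x ∘ y) ∘ (w ∘ z).
Proof.
have := jordan2 (x + w) y z; have := jordan2 w y z; have := jordan2 x y z.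
rewrite !jlinE ?scalerDr [w ∘ x]jmulC [w ∘ y]jmulC => h1 h2 h3.
by jlin.
Qed.

(** Multiplication by [c] is annihilated by t (2t - 1)(t - 1), so its only possible eigenvalues are
    0, 1/2 and 1. *)
Lemma peirce_poly c x : jidempotent c ->
  2 *: (c ∘ (c ∘ (c ∘ x))) + c ∘ x = 3 *: (c ∘ (c ∘ x)).
Proof.
move=> cc; have := jordan2 c x c; rewrite !cc [c ∘ x ∘ c]jmulC [x ∘ c]jmulC.
by jlin.
Qed.

(** On eigenvectors, [jordan2] factors as (2s - 1)(c(xy) - t xy) = 0. Hence multiplication by
    elements of the 0- and 1-spaces preserves every Peirce space. *)
Lemma peirce_mul c x y s t : jidempotent c -> c ∘ x = s *: x -> s != 2^-1 ->
  c ∘ y = t *: y -> c ∘ (x ∘ y) = t *: (x ∘ y).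
Proof.
move=> cc cx s2 cy; have := jordan2 c x y.
rewrite cc cx cy !jlinE => h.
have /eqP : (2 * s - 1) *: (c ∘ (x ∘ y) - t *: (x ∘ y)) = 0 by jlin.
rewrite scaler_eq0 => /orP[/eqP h2|].
  by case/eqP: s2; clear -h2; lra.
by rewrite subr_eq0 => /eqP.
Qed.

Lemma peirce0M c x y t : jidempotent c -> c ∘ x = 0 -> c ∘ y = t *: y ->
  c ∘ (x ∘ y) = t *: (x ∘ y).
Proof. by move=> cc cx cy; apply: (@peirce_mul c x y 0); rewrite ?scale0r// eq_sym invr_eq0 pnatr_eq0. Qed.

Lemma peirce1M c x y t : jidempotent c -> c ∘ x = x -> c ∘ y = t *: y ->
  c ∘ (x ∘ y) = t *: (x ∘ y).
Proof. by move=> cc cx cy; apply: (@peirce_mul c x y 1); rewrite ?scale1r//; apply/eqP; clear; lra. Qed.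

(** The product lies in both the 0-space and the 1-space of [c]. *)
Lemma peirce10 c x y : jidempotent c -> c ∘ x = x -> c ∘ y = 0 -> x ∘ y = 0.
Proof.
move=> cc cx cy.
have h1 : c ∘ (x ∘ y) = 0 *: (x ∘ y) by apply: peirce1M; rewrite ?scale0r.
have : c ∘ (y ∘ x) = 1 *: (y ∘ x) by apply: peirce0M; rewrite ?scale1r.
by rewrite [y ∘ x]jmulC h1 scale0r scale1r.
Qed.

(** The conclusion says that a product of two vectors of the 1/2-space has no component in the
    1/2-space. *)
Lemma peirce_half c x y : jidempotent c ->
  c ∘ x = 2^-1 *: x -> c ∘ y = 2^-1 *: y -> c ∘ (c ∘ (x ∘ y)) = c ∘ (x ∘ y).
Proof.
move=> cc cx cy; have := jordan3 x y c c.
rewrite cc [y ∘ c]jmulC [x ∘ c]jmulC cx cy [x ∘ y ∘ c]jmulC !jlinE.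
rewrite [y ∘ c]jmulC [x ∘ c]jmulC cx cy !jlinE [y ∘ x]jmulC.
by jlin.
Qed.

(** The polynomial t (2t - 1) is 0, 0, 1 at 0, 1/2, 1, so the vector in question is the Peirce
    1-component of [x]. *)
Lemma peirce_one c x : jidempotent c ->
  c ∘ (2 *: (c ∘ (c ∘ x)) - c ∘ x) = 2 *: (c ∘ (c ∘ x)) - c ∘ x.
Proof. by move=> cc; have := peirce_poly x cc; rewrite !jlinE; jlin. Qed.

Lemma idem_one_minus c : jidempotent c -> jidempotent (jone - c).
Proof. by rewrite /jidempotent => cc; rewrite !jlinE cc; jlin. Qed.

Lemma idemD c d : jidempotent c -> jidempotent d -> c ∘ d = 0 ->
  jidempotent (c + d).
Proof.
rewrite /jidempotent => cc dd cd.
by rewrite !jlinE cc dd [d ∘ c]jmulC cd addr0 add0r.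
Qed.

Lemma orth_commute c d z : jidempotent c -> c ∘ d = 0 ->
  c ∘ (d ∘ z) = d ∘ (c ∘ z).
Proof.
by move=> cc cd; have := jordan2 c d z; rewrite cc cd !jlinE; jlin.
Qed.

(** [d] lies in the 0-space of [c], so it kills the Peirce 1-component of [z]. As the two
    multiplications commute, [d ∘ z] has no 1-component, and [c] acts on it with eigenvalues 0 and
    1/2 only. *)
Lemma orth_half c d z : jidempotent c -> jidempotent d -> c ∘ d = 0 ->
  c ∘ (c ∘ (d ∘ z)) = 2^-1 *: (c ∘ (d ∘ z)).
Proof.
move=> cc dd cd.
have dc : d ∘ c = 0 by rewrite jmulC.
have := peirce10 cc (peirce_one z cc) cd.
rewrite !jlinE [_ ∘ d]jmulC [_ ∘ d]jmulC -!(orth_commute _ cc cd).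
by jlin.
Qed.

(* With P_1 and P_1/2 the Peirce projections of c,
   <c x, x> = |P_1 x|^2 + |P_1/2 x|^2 / 2 and <c x, c x> = |P_1 x|^2 + |P_1/2 x|^2 / 4. *)
Lemma idem_mul_le c x : jidempotent c -> ⟨c ∘ x, c ∘ x⟩ <= ⟨c ∘ x, x⟩.
Proof.
move=> cc; have := peirce_poly x cc => /(congr1 (fun t => ⟨t, x⟩)).
have := peirce_poly (c ∘ x) cc => /(congr1 (fun t => ⟨t, x⟩)).
rewrite !jipE.
have := jip_ge0 (2 *: (c ∘ (c ∘ x)) - c ∘ x).
have := jip_ge0 (c ∘ (c ∘ x) - c ∘ x).
have cE y z : ⟨y, c ∘ z⟩ = ⟨c ∘ y, z⟩ by rewrite jip_jmulr [y ∘ c]jmulC.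
rewrite !jipE !jipDr !jipZr !jipNr !cE.
lra.
Qed.

(** By associativity of the form, [⟨c, d⟩ = ⟨c ∘ d, d⟩], which [idem_mul_le] bounds below by the
    squared norm of [c ∘ d]. *)
Lemma idem_jip_ge0 c d : jidempotent c -> jidempotent d -> 0 <= ⟨c, d⟩.
Proof.
move=> cc dd; have := idem_mul_le d cc; rewrite [X in _ <= X]jip_jmul dd.
by apply: le_trans; exact: jip_ge0.
Qed.

Lemma idem_jip_eq0 c d : jidempotent c -> jidempotent d -> ⟨c, d⟩ = 0 -> c ∘ d = 0.
Proof.
move=> cc dd cd; have := idem_mul_le d cc; rewrite [X in _ <= X]jip_jmul dd cd.
by move=> h; apply/eqP; rewrite -jip_eq0 eq_le h jip_ge0.
Qed.

End Peirce.

(** * Power associativity and polynomials evaluated at an element *)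

Section PolynomialCalculus.
Variables (R : realType) (E : ejaType R) (y : E).
Implicit Types (p q : {poly R}) (b z : E) (s : seq R).

Definition jpow n : E := iter n (jmul y) jone.

Definition jeval p : E := \sum_(i < size p) p`_i *: jpow i.

Let commuting b :=
  (forall z, b ∘ (y ∘ z) = y ∘ (b ∘ z)) /\
  (forall z, b ∘ ((y ∘ y) ∘ z) = (y ∘ y) ∘ (b ∘ z)).

(** [jordan3] expresses multiplication by [y ∘ (y ∘ b)] through multiplications by [y], [y ∘ y], [b]
    and [y ∘ b]; those by [y] and [y ∘ y] commute by the Jordan identity. Hence the induction over
    two consecutive powers. *)
Let commuting_step b : commuting b -> commuting (y ∘ b) -> commuting (y ∘ (y ∘ b)).
Proof.
move=> [b1 b2] [c1 c2].
have key z : (y ∘ (y ∘ b)) ∘ z = (y ∘ y) ∘ (b ∘ z) + 2 *: ((y ∘ b) ∘ (y ∘ z))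
    - y ∘ (y ∘ (b ∘ z)) - b ∘ (y ∘ (y ∘ z)).
  have := jordan3 y b z y.
  rewrite [z ∘ y]jmulC [b ∘ y]jmulC [b ∘ z ∘ y]jmulC [y ∘ z ∘ y]jmulC.
  rewrite [b ∘ z ∘ (y ∘ y)]jmulC [y ∘ z ∘ (y ∘ b)]jmulC [y ∘ b ∘ y]jmulC.
  rewrite [z ∘ (y ∘ (y ∘ b))]jmulC.
  by clear; jlin.
have yy z : (y ∘ y) ∘ (y ∘ z) = y ∘ ((y ∘ y) ∘ z) by rewrite jmul_jordan.
split=> z; rewrite !key !jlinE.
  by rewrite !(b1, c1, yy).
by rewrite !(b1, b2, c2, esym (yy _)).
Qed.

Let jpow_commuting n : commuting (jpow n).
Proof.
suff [] : commuting (jpow n) /\ commuting (jpow n.+1) by [].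
elim: n => [|n [IH1 IH2]]; last by split=> //; exact: commuting_step.
split; first by split=> z; rewrite !jmul1l.
rewrite /= /commuting jmul1r; split=> z //; by rewrite jmul_jordan.
Qed.

Lemma jeval_widen n p : (size p <= n)%N -> jeval p = \sum_(i < n) p`_i *: jpow i.
Proof.
move=> pn; rewrite /jeval (big_ord_widen n (fun i => p`_i *: jpow i))// big_mkcond.
apply: eq_bigr => i _; case: ltnP => // h.
by rewrite nth_default// scale0r.
Qed.

Lemma jevalD p q : jeval (p + q) = jeval p + jeval q.
Proof.
rewrite (jeval_widen (size_polyD p q)) (jeval_widen (leq_maxl (size p) (size q))).
rewrite (jeval_widen (leq_maxr (size p) (size q))) -big_split.
by apply: eq_bigr => i _; rewrite coefD scalerDl.
Qed.

Lemma jevalZ a p : jeval (a *: p) = a *: jeval p.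
Proof.
rewrite (jeval_widen (size_scale_leq a p)) scaler_sumr.
by apply: eq_bigr => i _; rewrite coefZ scalerA.
Qed.

Lemma jeval0 : jeval 0 = 0.
Proof. by rewrite /jeval size_poly0 big_ord0. Qed.

Lemma jevalC a : jeval a%:P = a *: jone.
Proof.
by rewrite (jeval_widen (size_polyC_leq1 a)) big_ord1 coefC.
Qed.

Lemma jevalMX p : jeval (p * 'X) = y ∘ jeval p.
Proof.
have le : (size (p * 'X)%R <= (size p).+1)%N.
  by apply: leq_trans (size_polyMleq _ _) _; rewrite size_polyX addn2.
rewrite (jeval_widen le) big_ord_recl coefMX eqxx scale0r add0r jmul_sumr.
by apply: eq_bigr => i _; rewrite coefMX/= jmulZr.
Qed.

Lemma jevalX : jeval 'X = y.
Proof. by rewrite -[X in jeval X]mul1r jevalMX jevalC scale1r jmul1r. Qed.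

Lemma jevalB p q : jeval (p - q) = jeval p - jeval q.
Proof. by rewrite jevalD -scaleN1r jevalZ scaleN1r. Qed.

Lemma jeval_sum (I : Type) (r : seq I) (F : I -> {poly R}) :
  jeval (\sum_(i <- r) F i) = \sum_(i <- r) jeval (F i).
Proof. exact: (big_morph _ jevalD jeval0). Qed.

(** Multiplication by [jeval q] commutes with multiplication by [y], so the factors ['X] of [p] can
    be peeled off one at a time. *)
Lemma jevalM p q : jeval (p * q) = jeval p ∘ jeval q.
Proof.
elim/poly_ind: p => [|p c IH]; first by rewrite mul0r jeval0 jmul0l.
have comm z : jeval q ∘ (y ∘ z) = y ∘ (jeval q ∘ z).
  rewrite /jeval !jmul_suml jmul_sumr; apply: eq_bigr => i _.
  by rewrite !jmulZl (jpow_commuting i).1 jmulZr.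
rewrite mulrDl mulrAC mul_polyC !jevalD !jevalMX jevalZ jevalC IH.
by rewrite !jlinE [y ∘ _ ∘ _]jmulC comm [jeval q ∘ _]jmulC.
Qed.

Lemma jeval_norm p : ⟨jeval p, jeval p⟩ = ⟨jone, jeval (p * p)⟩.
Proof. by rewrite jevalM jip_jmulr jmul1l. Qed.

Lemma jeval_sq_eq0 p : jeval (p * p) = 0 -> jeval p = 0.
Proof.
by move=> pp; apply/eqP; rewrite -jip_eq0 jeval_norm pp jip0r.
Qed.

Lemma jeval_annihilator : exists2 p, p != 0 & jeval p = 0.
Proof.
pose n := (\dim {:E}).+1; pose X := [tuple jpow i | i < n].
have : ~~ free X.
  rewrite /free size_tuple neq_ltn; apply/orP; left.
  by rewrite ltnS dimvS// subvf.
move=> /(elimN freeP)/existsNP[k /not_implyP[k0 /existsNP[i /eqP ki]]].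
exists (\poly_(j < n) k (inord j)).
  apply: contra_neq ki => /(congr1 (fun p => p`_i)).
  by rewrite coef_poly ltn_ord inord_val coef0.
rewrite (jeval_widen (size_poly _ _)) -[RHS]k0; apply: eq_bigr => j _.
by rewrite coef_poly ltn_ord inord_val -tnth_nth tnth_mktuple.
Qed.

End PolynomialCalculus.

(** [p] has a root a + ib in the algebraically closed field of complex numbers over [R]; the factor
    is the minimal polynomial of that root over [R]. *)
Lemma rcf_poly_factor (R : rcfType) (p : {poly R}) : (1 < size p)%N ->
  exists (a b : R) (q : {poly R}),
    p = ('X - a%:P) * q \/ b != 0 /\ p = (('X - a%:P) ^+ 2 + (b ^+ 2)%:P) * q.
Proof.
move=> p1; pose f := map_poly (real_complex R).
have /closed_rootP[[a b] rp] : size (f p) != 1%N by rewrite size_map_poly gtn_eqF.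
exists a, b.
pose d := ('X - a%:P) ^+ 2 + (b ^+ 2)%:P.
have [b0|b0] := eqVneq b 0.
  have /factor_theorem[q ->] : root p a.
    by move: rp; rewrite b0 [Complex a 0]/(real_complex R a) fmorph_root.
  by exists q; left; rewrite mulrC.
exists (p %/ d); right; split=> //.
have sd : size d = 3%N.
  rewrite size_polyDl ?size_exp_XsubC// size_polyC.
  by case: eqP.
have sr : (size (p %% d)%R < 3)%N by rewrite -sd ltn_modp -size_poly_eq0 sd.
set r := p %% d in sr.
suff r0 : r = 0 by rewrite [LHS](divp_eq p d) -/r r0 addr0 mulrC.
(* The remainder has degree at most 1 and vanishes at a + ib with [b != 0]: the imaginary part kills
   its slope, then the real part its constant term. *)
have rE : r = (r`_0)%:P + r`_1 *: 'X.
  apply/polyP => i; rewrite coefD coefC coefZ coefX.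
  case: i => [|[|i]] /=; rewrite ?mulr0 ?addr0 ?mulr1 ?add0r//.
  by rewrite nth_default//; apply: (@leq_trans 2).
have : (f r).[Complex a b] = 0.
  move: rp; rewrite /root {1}(divp_eq p d) -/r /f rmorphD rmorphM hornerD hornerM.
  suff -> : (map_poly (real_complex R) d).[Complex a b] = 0.
    by rewrite mulr0 add0r => /eqP.
  rewrite /d rmorphD rmorphXn rmorphB /= !map_polyC map_polyX !hornerE/=.
  apply/eqP; rewrite eq_complex/= !expr2; simpc => /=.
  by rewrite addNr eqxx.
rewrite rE /f rmorphD /= map_polyC map_polyZ map_polyX !hornerE => /eqP.
rewrite eq_complex /= => /andP[/eqP h1 /eqP h2].
move: h1 h2; rewrite /= !mul0r !subr0 !addr0 add0r => h1 /eqP.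
rewrite mulf_eq0 (negbTE b0) orbF => /eqP r1.
move: h1; rewrite r1 mul0r addr0 => r0.
by rewrite r0 scale0r addr0.
Qed.

(** * Spectral decomposition along a Jordan frame *)

Section Spectral.
Variables (R : realType) (E : ejaType R).
Implicit Types (x y z c : E) (s : seq R).

(* Positivity of the inner product cancels irreducible quadratic factors and
   repeated linear factors of an annihilating polynomial. *)
Lemma jeval_split y (p : {poly R}) : p != 0 ->
  exists2 s, uniq s & forall v, jeval y (p * v) = 0 ->
    jeval y (\prod_(a <- s) ('X - a%:P) * v) = 0.
Proof.
(* The free factor [v] absorbs a linear factor split off from [p], so that the induction hypothesis
   applies to the quotient. *)
have [n] := ubnP (size p); elim: n p => // n IH p pn p0.
have [p1|p1] := leqP (size p) 1.
  exists [::] => // v; rewrite big_nil mul1r (size1_polyC p1) mul_polyC jevalZ.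
  have c0 : p`_0 != 0 by apply: contra_neq p0 => c0; rewrite (size1_polyC p1) c0.
  by move=> /eqP; rewrite scaler_eq0 (negPf c0) => /eqP.
have [a [b [q [pE|[b0 pE]]]]] := rcf_poly_factor p1.
  have q0 : q != 0 by apply: contra_neq p0 => q0; rewrite pE q0 mulr0.
  have qn : (size q < n)%N.
    by move: pn; rewrite pE size_monicM ?monicXsubC// size_XsubC.
  have [s us hs] := IH q qn q0.
  have hs' v : jeval y (p * v) = 0 ->
      jeval y (('X - a%:P) * (\prod_(a <- s) ('X - a%:P) * v)) = 0.
    move=> h; rewrite mulrCA; apply: hs; by rewrite mulrA [q * _]mulrC -pE.
  have [sa|sa] := boolP (a \in s); last first.
    by exists (a :: s) => [|v h]; rewrite /= ?sa// big_cons -mulrA hs'.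
  (* The root [a] is already listed: the square of the product is a multiple of the polynomial
     annihilated in [h]. *)
  exists s => // v /hs' h; apply: jeval_sq_eq0.
  rewrite {1}(big_rem a sa)/= -[RHS](jmul0r (jeval y (\prod_(c <- rem a s) ('X - c%:P) * v))).
  by rewrite -h -jevalM; congr jeval; ring.
have q0 : q != 0 by apply: contra_neq p0 => q0; rewrite pE q0 mulr0.
have sd : size (('X - a%:P) ^+ 2 + (b ^+ 2)%:P) = 3%N.
  by rewrite size_polyDl ?size_exp_XsubC// size_polyC; case: eqP.
have qn : (size q < n)%N.
  move: pn; rewrite pE size_mul// -?size_poly_eq0 sd//=.
  by rewrite !ltnS => h; apply: leq_trans h; rewrite ltnW// ltnS.
have [s us hs] := IH q qn q0.
exists s => // v h; apply: hs; set w := q * v.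
apply/eqP; rewrite -jip_eq0; apply/eqP.
(* This polynomial is [w * (p * v)]. Paired with [jone], its value is a sum of two nonnegative
   terms, the second being [b ^+ 2] times the squared norm of [jeval y w]. *)
have : jeval y ((('X - a%:P) * w) * (('X - a%:P) * w) + b ^+ 2 *: (w * w)) = 0.
  rewrite -[RHS](jmul0r (jeval y w)) -[X in _ = _ ∘ X]h -jevalM; congr jeval.
  by rewrite -mul_polyC pE /w; ring.
rewrite jevalD jevalZ => /(congr1 (jip jone)).
rewrite jipDr jipZr -!jeval_norm jip0r => /eqP.
rewrite paddr_eq0 ?jip_ge0//; last by rewrite mulr_ge0 ?jip_ge0 ?sqr_ge0.
by move=> /andP[_]; rewrite mulf_eq0 sqrf_eq0 (negPf b0) => /eqP.
Qed.

Lemma jeval_eq_on y s p q : uniq s ->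
  jeval y (\prod_(a <- s) ('X - a%:P)) = 0 ->
  (forall a, a \in s -> p.[a] = q.[a]) -> jeval y p = jeval y q.
Proof.
move=> us hs pq; apply/eqP; rewrite -subr_eq0 -jevalB.
have [||r ->] := @uniq_roots_prod_XsubC _ (p - q) s.
- by apply/allP => a /pq pqa; rewrite /root !hornerE pqa subrr.
- by rewrite uniq_rootsE.
by rewrite jevalM hs jmul0r.
Qed.

(** The idempotents are the values at [y] of the Lagrange interpolation polynomials on [s]. Some may
    be zero, since [s] can contain points that are not eigenvalues. *)
Lemma spectral_distinct y : exists s (e : R -> E), [/\ uniq s,
  forall a b, a \in s -> b \in s -> e a ∘ e b = if a == b then e a else 0,
  \sum_(a <- s) e a = jone & y = \sum_(a <- s) a *: e a].
Proof.
have [p p0 py] := jeval_annihilator y.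
have [s us /(_ 1)] := jeval_split y p0; rewrite !mulr1 => /(_ py) hs.
pose l a := \prod_(b <- rem a s) ('X - b%:P).
pose L a := (l a).[a]^-1 *: l a.
have LE a b : a \in s -> b \in s -> (L a).[b] = (a == b)%:R.
  move=> sa sb; rewrite hornerZ.
  have [<-|ab] := eqVneq a b.
    rewrite mulVf// -/(root _ _) root_prod_XsubC.
    by rewrite mem_rem_uniq// !inE eqxx.
  suff /rootP -> : root (l a) b by rewrite mulr0.
  by rewrite root_prod_XsubC mem_rem_uniq// !inE eq_sym ab.
exists s, (fun a => jeval y (L a)); split=> //.
- move=> a b sa sb; rewrite -jevalM.
  have [->|ab] := eqVneq a b.
    apply: (jeval_eq_on us hs) => c sc; rewrite hornerM !LE//.
    by case: eqP; rewrite ?mulr1 ?mulr0.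
  rewrite -[RHS](jeval0 y); apply: (jeval_eq_on us hs) => c sc.
  rewrite hornerM !LE// horner0; case: eqP => [<-|]; rewrite ?mul0r//.
  by rewrite eq_sym (negPf ab) mulr0.
- rewrite -jeval_sum -[RHS]scale1r -(jevalC y); apply: (jeval_eq_on us hs) => c sc.
  rewrite horner_sum hornerC (bigD1_seq c)//= LE// eqxx big_seq_cond big1 ?addr0//.
  by move=> a /andP[sa /negPf ac]; rewrite LE// ac.
- under eq_bigr do rewrite -jevalZ.
  rewrite -jeval_sum -[LHS](jevalX y); apply: (jeval_eq_on us hs) => c sc.
  rewrite hornerX horner_sum (bigD1_seq c)//= hornerZ LE// eqxx big_seq_cond.
  rewrite big1 ?addr0 ?mulr1// => a /andP[sa /negPf ac].
  by rewrite hornerZ LE// ac mulr0.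
Qed.

(** A Jordan frame with primitivity weakened to nonvanishing: the invariant kept while idempotents
    are being split. *)
Definition orth_system n (c : 'I_n -> E) :=
  [/\ forall i, jidempotent (c i), forall i, c i != 0,
      forall i j, i != j -> c i ∘ c j = 0 & \sum_(i < n) c i = jone].

(** Nonzero orthogonal idempotents are linearly independent. This bound makes the refinement into
    primitive idempotents terminate. *)
Lemma orth_system_size n (c : 'I_n -> E) : orth_system c -> (n <= \dim {:E})%N.
Proof.
move=> [cc c0 cij _]; pose X := [tuple c i | i < n].
suff : free X by rewrite /free size_tuple => /eqP <-; rewrite dimvS// subvf.
apply/freeP => k /[swap] i /(congr1 (jmul (c i))).
rewrite jmul0r jmul_sumr (eq_bigr (fun j => k j *: (c i ∘ c j))) => [|j _]; last first.
  by rewrite jmulZr -tnth_nth tnth_mktuple.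
rewrite (bigD1 i)//= big1 => [|j ji]; last by rewrite cij ?scaler0// eq_sym.
by rewrite addr0 cc => /eqP; rewrite scaler_eq0 (negPf (c0 i)) orbF => /eqP.
Qed.

Lemma orth_system_split n (c : 'I_n -> E) (u : 'I_n -> R) i0 :
  orth_system c -> ~ jprimitive (c i0) ->
  exists (c' : 'I_n.+1 -> E) (u' : 'I_n.+1 -> R), orth_system c' /\
    \sum_(i < n) u i *: c i = \sum_(i < n.+1) u' i *: c' i.
Proof.
move=> [cc c0 cij csum] np.
have [a [b [[aa a0] [bb b0] ab cab]]] : exists a b : E,
    [/\ jidempotent a /\ a != 0, jidempotent b /\ b != 0, a ∘ b = 0 & c i0 = a + b].
  by apply: contrapT => h; apply: np; split.
have ca : c i0 ∘ a = a by rewrite cab jmulDl aa jmulC ab addr0.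
have cb : c i0 ∘ b = b by rewrite cab jmulDl bb ab add0r.
have ac i : i != i0 -> a ∘ c i = 0.
  by move=> ii; apply: (peirce10 (cc i0)) => //; rewrite cij// eq_sym.
have bc i : i != i0 -> b ∘ c i = 0.
  by move=> ii; apply: (peirce10 (cc i0)) => //; rewrite cij// eq_sym.
pose c1 i := if i == i0 then a else c i.
(* [b] takes the new index 0 and [a] the place of [c i0]; both inherit the coefficient [u i0]. *)
pose c' j := if unlift ord0 j is Some i then c1 i else b.
pose u' j := if unlift ord0 j is Some i then u i else u i0.
have bc1 i : b ∘ c1 i = 0.
  by rewrite /c1; case: eqVneq => [_|/bc//]; rewrite jmulC.
have split1 (v : 'I_n -> R) :
    \sum_(i < n) v i *: c i = v i0 *: b + \sum_(i < n) v i *: c1 i.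
  rewrite (bigD1 i0)//= [in RHS](bigD1 i0)//= /c1 eqxx cab scalerDr addrA.
  rewrite [v i0 *: b + _]addrC; congr (_ + _).
  by apply: eq_bigr => i /negPf ->.
exists c', u'; split; last first.
  rewrite big_ord_recl /u' /c' unlift_none split1; congr (_ + _).
  by apply: eq_bigr => i _; rewrite liftK.
split.
- by rewrite /c' /c1 => j; case: unliftP => [i _|_]; [case: ifP|].
- by rewrite /c' /c1 => j; case: unliftP => [i _|_]; [case: ifP|].
- move=> j k; rewrite /c'; case: (unliftP ord0 j) => [i ->|->]; case: (unliftP ord0 k) => [i' kE|kE].
  + move=> ll; have : i != i' by apply: contra_neq ll => ii; rewrite ii kE.
    rewrite /c1; case: (eqVneq i i0) => [->|i1]; case: (eqVneq i' i0) => [_|i2] //.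
    * by rewrite ac.
    * by rewrite jmulC ac.
    * exact: cij.
  + by rewrite jmulC bc1.
  + by rewrite bc1.
  + by rewrite kE eqxx.
- rewrite big_ord_recl /c' unlift_none -csum.
  have := split1 (fun=> 1); rewrite scale1r; under eq_bigr do rewrite scale1r.
  move=> ->; congr (_ + _).
  by apply: eq_bigr => i _; rewrite liftK scale1r.
Qed.

Lemma orth_system_refine n (c : 'I_n -> E) (u : 'I_n -> R) : orth_system c ->
  exists m (c' : 'I_m -> E) (u' : 'I_m -> R), jordan_frame c' /\
    \sum_(i < n) u i *: c i = \sum_(i < m) u' i *: c' i.
Proof.
have [k] := ubnP (\dim {:E} - n).
elim: k n c u => // k IH n c u kn hc.
have [hp|/existsNP[i ni]] := pselect (forall i, jprimitive (c i)).
  by exists n, c, u; split => //; case: hc.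
have [c' [u' [hc' ->]]] := orth_system_split u hc ni.
apply: IH => //; apply: leq_trans (_ : (\dim {:E} - n <= k)%N); last by rewrite -ltnS.
by rewrite ltn_sub2l// (orth_system_size hc').
Qed.

Lemma spectral_frame y : exists m (c : 'I_m -> E) (u : 'I_m -> R),
  jordan_frame c /\ y = \sum_(i < m) u i *: c i.
Proof.
have [s [e [us es e1 ->]]] := spectral_distinct y.
(* The spurious points of [s] are discarded, as an [orth_system] has no zero member. *)
pose t := [seq a <- s | e a != 0].
have sum_t (v : R -> R) : \sum_(a <- s) v a *: e a =
    \sum_(i < size t) v t`_i *: e t`_i.
  rewrite -(big_mkord xpredT (fun i => v t`_i *: e t`_i)) -(big_nth 0 xpredT (fun a => v a *: e a)).
  rewrite big_filter [RHS]big_mkcond; apply: eq_bigr => a _.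
  by case: eqP => [->|//]; rewrite scaler0.
have ts (i : 'I_(size t)) : e t`_i != 0 /\ t`_i \in s.
  by have := mem_nth 0 (ltn_ord i); rewrite mem_filter => /andP.
rewrite sum_t; apply: orth_system_refine; split.
- by move=> i; have [_ h] := ts i; rewrite /jidempotent es// eqxx.
- by move=> i; have [] := ts i.
- move=> i j ij; have [_ hi] := ts i; have [_ hj] := ts j.
  by rewrite es// nth_uniq ?filter_uniq// val_eqE (negPf ij).
- rewrite -e1; have := sum_t (fun=> 1).
  by under eq_bigr do rewrite scale1r; under [RHS]eq_bigr do rewrite scale1r.
Qed.

Lemma jeigenvaluesP y : spectrum_of y (jeigenvalues y).
Proof.
apply: xgetPex; have [m [c [u [hc ->]]]] := spectral_frame y.
(* The family [u] as a list; the default 0 is never reached, since every index is below [m]. *)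
pose s := mkseq (fun i => if insub i is Some j then u j else 0) m.
have sm : size s = m by rewrite size_mkseq.
have su (i : 'I_m) : s`_i = u i by rewrite nth_mkseq// insubT//= => h; congr u; exact: val_inj.
exists s; move: s sm su => s sm; subst m => su.
by exists c => //; apply: eq_bigr => i _; rewrite su.
Qed.

Lemma jalg_rankP : exists c : 'I_(jalg_rank E) -> E, jordan_frame c.
Proof.
apply: (@xgetPex nat 0%N [set r | exists c : 'I_r -> E, jordan_frame c]%classic).
by have [m [c [u [hc _]]]] := spectral_frame 0; exists m, c.
Qed.

End Spectral.

(** * Computing along a fixed Jordan frame *)

Section JordanFrames.
Variables (R : realType) (E : ejaType R).
Implicit Types (x y z w c d : E).

(** Makes kernels of multiplication operators available as subspaces through [linfun]. *)
HB.instance Definition _ c := GRing.isLinear.Build R E E *:%R (jmul c)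
  (fun a x y => etrans (jmulDr (a *: x) y c) (congr1 (+%R^~ (c ∘ y)) (jmulZr a x c))).

(** Otherwise [c] would split as the orthogonal sum of [d] and [c - d]. *)
Lemma primitive_eq c d : jprimitive c -> jidempotent d -> d != 0 -> c ∘ d = d -> d = c.
Proof.
move=> [cc _ np] dd d0 cd; apply/eqP; rewrite eq_sym -subr_eq0; apply/negP => /negP e0.
apply: np; exists d, (c - d); split=> //.
- split=> //; rewrite /jidempotent !jlinE cc dd cd [d ∘ c]jmulC cd.
  by clear; jlin.
- by rewrite jmulDr jmulNr dd jmulC cd subrr.
- by rewrite addrC subrK.
Qed.

Variables (n : nat) (c : 'I_n -> E).
Hypothesis fc : jordan_frame c.
Implicit Types (u : 'I_n -> R) (P : pred 'I_n).

Let prim i : jprimitive (c i). Proof. by case: fc. Qed.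

Let idem i : jidempotent (c i). Proof. by case: (prim i). Qed.

Let orth i j : i != j -> c i ∘ c j = 0. Proof. by case: fc => _ + _; apply. Qed.

Lemma frame_sum_mul w : \sum_(i < n) c i ∘ w = w.
Proof. by rewrite -jmul_suml; case: fc => _ _ ->; rewrite jmul1l. Qed.

Lemma frame_mul u i : c i ∘ (\sum_(j < n) u j *: c j) = u i *: c i.
Proof.
rewrite jmul_sumr (bigD1 i)//= big1 ?addr0 ?jmulZr ?idem// => j ji.
by rewrite jmulZr orth ?scaler0// eq_sym.
Qed.

Lemma frame_sq u :
  (\sum_(i < n) u i *: c i) ∘ (\sum_(i < n) u i *: c i) = \sum_(i < n) u i ^+ 2 *: c i.
Proof.
rewrite {1}jmul_suml; apply: eq_bigr => i _.
by rewrite jmulZl frame_mul scalerA -expr2.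
Qed.

Lemma frame_sub_mul P i : (\sum_(j < n | P j) c j) ∘ c i = if P i then c i else 0.
Proof.
rewrite big_mkcond jmulC.
rewrite (eq_bigr (fun j => (P j)%:R *: c j)) => [|j _]; last first.
  by case: (P j); rewrite ?scale1r ?scale0r.
by rewrite frame_mul; case: (P i); rewrite ?scale1r ?scale0r.
Qed.

Lemma frame_sub_idem P : jidempotent (\sum_(j < n | P j) c j).
Proof.
rewrite /jidempotent jmul_sumr; apply: eq_bigr => i Pi.
by rewrite frame_sub_mul Pi.
Qed.

(** Writing x for the combination, 0 = ⟨d x, x⟩ = ⟨d, x^2⟩ is the sum of the nonnegative terms
    [u j ^+ 2 * ⟨d, c j⟩], so each term vanishes. *)
Lemma frame_supp_orth u d i : jidempotent d ->
  d ∘ (\sum_(j < n) u j *: c j) = 0 -> u i != 0 -> d ∘ c i = 0.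
Proof.
move=> dd dx ui; apply: idem_jip_eq0 => //.
have /eqP : \sum_(j < n) u j ^+ 2 * ⟨d, c j⟩ = 0.
  under eq_bigr do rewrite -jipZr.
  by rewrite -jip_sumr -frame_sq jip_jmulr dx jip0l.
rewrite psumr_eq0 => [|j _]; last by rewrite mulr_ge0 ?sqr_ge0 ?idem_jip_ge0.
move=> /allP/(_ i); rewrite mem_index_enum => /(_ isT).
by rewrite mulf_eq0 sqrf_eq0 (negPf ui) => /eqP.
Qed.

End JordanFrames.

(** * Peirce spaces of primitive idempotents and links between them *)

Section PrimitiveIdempotents.
Variables (R : realType) (E : ejaType R).
Implicit Types (x y z w a b c d f : E).

(** Diagonalize [x]: each frame member with nonzero eigenvalue is orthogonal to [jone - c], hence
    fixed by [c], hence equal to [c] by primitivity. *)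
Lemma primitive_peirce1 c x : jprimitive c -> c ∘ x = x -> exists t : R, x = t *: c.
Proof.
move=> pc cx; have [cc _ _] := pc.
have [m [d [u [hd xE]]]] := spectral_frame x.
exists (\sum_i u i); rewrite scaler_suml xE; apply: eq_bigr => i _.
have [->|ui] := eqVneq (u i) 0; first by rewrite !scale0r.
congr (_ *: _); have [/(_ i)[dd d0 _] _ _] := hd.
apply: (primitive_eq pc) => //.
have : (jone - c) ∘ d i = 0.
  apply: (frame_supp_orth hd (u := u)) => //; first exact: idem_one_minus.
  by rewrite -xE jmulDl jmulNl jmul1l cx subrr.
by rewrite jmulDl jmulNl jmul1l => /eqP; rewrite subr_eq0 => /eqP.
Qed.

(** For two distinct members of a frame this is the off-diagonal Peirce space. *)
Definition peirce_link c d w := c ∘ w = 2^-1 *: w /\ d ∘ w = 2^-1 *: w.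

Lemma peirce_link_sum c d w : peirce_link c d w -> (c + d) ∘ w = w.
Proof. by move=> [cw dw]; rewrite jmulDl cw dw; clear; jlin. Qed.

Lemma peirce_link_orth c d f w : jidempotent c -> jidempotent d -> c ∘ d = 0 ->
  c ∘ f = 0 -> d ∘ f = 0 -> peirce_link c d w -> f ∘ w = 0.
Proof.
move=> cc dd cd cf df /peirce_link_sum cdw; rewrite jmulC.
by apply: (peirce10 (idemD cc dd cd)) => //; rewrite jmulDl cf df addr0.
Qed.

(** Up to the factor 4, multiplying by [d] and then by [c] is the projection onto the linking
    space. *)
Lemma peirce_link_jmul c d w : jidempotent c -> jidempotent d -> c ∘ d = 0 ->
  peirce_link c d (c ∘ (d ∘ w)).
Proof.
move=> cc dd cd; have dc : d ∘ c = 0 by rewrite jmulC.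
by split; rewrite ?orth_half// (orth_commute _ cc cd) orth_half.
Qed.

(** [w ∘ w] lies in the 1-space of [c + d], and by [peirce_half] its parts along [c] and [d] lie in
    their one-dimensional 1-spaces. Pairing the second part with [jone] gives [⟨d ∘ w, w⟩], half the
    squared norm of [w]. *)
Lemma peirce_link_sq c d w : jprimitive c -> jprimitive d -> c ∘ d = 0 ->
  peirce_link c d w ->
  exists s t : R, w ∘ w = s *: c + t *: d /\ (w != 0 -> t != 0).
Proof.
move=> pc pd cd cdw; have [[[cw dw] [cc c0 _]] [dd d0 _]] := (cdw, pc, pd).
have [s cs] := primitive_peirce1 pc (peirce_half cc cw cw).
have [t dt] := primitive_peirce1 pd (peirce_half dd dw dw).
exists s, t; split.
  have h := peirce_link_sum cdw.
  rewrite -cs -dt -jmulDl -[LHS]scale1r -[X in _ = X]scale1r.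
  rewrite (@peirce1M _ _ _ _ _ 1) ?scale1r//; exact: idemD.
move=> w0; apply/eqP => t0; move: dt; rewrite t0 scale0r.
move=> /(congr1 (jip jone)); rewrite jip_jmulr jmul1l jip0r jip_jmulr dw.
by rewrite jipZl => /eqP; rewrite mulf_eq0 invr_eq0 pnatr_eq0 jip_eq0 (negPf w0).
Qed.

(** Nonvanishing: with [a ∘ a = s *: c + t *: d], if [a ∘ b] were 0 then [jordan2] at [a], [b], [d]
    would reduce to (t/2) b = (t/4) b. *)
Lemma peirce_link_trans c d f a b : jprimitive c -> jprimitive d -> jprimitive f ->
  c ∘ d = 0 -> d ∘ f = 0 -> c ∘ f = 0 -> peirce_link c d a -> peirce_link d f b ->
  a != 0 -> b != 0 -> peirce_link c f (a ∘ b) /\ a ∘ b != 0.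
Proof.
move=> pc pd pf cd df cf ha hb a0 b0.
have [[[cc _ _] [dd _ _]] [ff _ _]] := (pc, pd, pf).
have fc : f ∘ c = 0 by rewrite jmulC.
have dc : d ∘ c = 0 by rewrite jmulC.
have fd : f ∘ d = 0 by rewrite jmulC.
have cb : c ∘ b = 0 by apply: (@peirce_link_orth d f).
have fa : f ∘ a = 0 by apply: (@peirce_link_orth c d).
have [[ca da] [db fb]] := (ha, hb).
have hab : peirce_link c f (a ∘ b).
  split; last by apply: peirce0M.
  by rewrite [a ∘ b]jmulC; apply: peirce0M.
have dab : d ∘ (a ∘ b) = 0 by apply: (@peirce_link_orth c f).
split=> //; apply/eqP => ab0.
have [s [t [aa /(_ a0) t0]]] := peirce_link_sq pc pd cd ha.
have := jordan2 a b d.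
rewrite ab0 aa [a ∘ d]jmulC da [b ∘ d]jmulC db !jlinE cd dd cb db.
rewrite !jlinE [b ∘ d]jmulC db => h.
have /eqP : t *: b = 0 by move: h; clear; jlin.
by rewrite scaler_eq0 (negPf t0) (negPf b0).
Qed.

(* If no Peirce space linked c_i and c_j, the sum of the idempotents linked to
   c_i would be a central idempotent, splitting the algebra. *)
Lemma simple_peirce_link n (c : 'I_n -> E) i j : jsimple E -> jordan_frame c ->
  i != j -> exists2 w, w != 0 & peirce_link (c i) (c j) w.
Proof.
move=> simpE fc; have [pc orth _] := fc.
pose L k l := k = l \/ exists2 w, w != 0 & peirce_link (c k) (c l) w.
have cc k : jidempotent (c k) by case: (pc k).
have Ltrans k l m : L k l -> L l m -> L k m.
  move=> [->//|[a a0 ha]] [<-|[b b0 hb]]; first by right; exists a.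
  have [->|km] := eqVneq k m; first by left.
  have [lk|kl] := eqVneq k l; first by right; exists b; rewrite ?lk.
  have [ml|lm] := eqVneq l m; first by right; exists a; rewrite -?ml.
  have [||| hab ab0] := peirce_link_trans (pc k) (pc l) (pc m) _ _ _ ha hb a0 b0.
  - exact: orth.
  - exact: orth.
  - exact: orth.
  by right; exists (a ∘ b).
pose P k := `[< L i k >]; pose p := \sum_(k < n | P k) c k.
have pp : jidempotent p by exact: frame_sub_idem.
have qE : jone - p = \sum_(k < n | ~~ P k) c k.
  by case: fc => _ _ <-; rewrite (bigID P)/= -/p addrAC subrr add0r.
(* [p] has no Peirce 1/2-space: a nonzero [c k ∘ (c l ∘ w)] would link an index [k] of the class of
   [i] to an index [l] outside it. *)
have pqw w : p ∘ ((jone - p) ∘ w) = 0.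
  rewrite qE !jmul_suml big1// => k Pk; rewrite jmul_sumr big1// => l Pl.
  have kl : k != l by apply: contraNneq Pl => <-.
  apply/eqP; apply/negPn/negP => v0; case/asboolP: Pl.
  apply: (Ltrans _ k); first exact/asboolP.
  by right; exists (c k ∘ (c l ∘ w)) => //; apply: peirce_link_jmul => //; exact: orth.
have q1 w : ((jone - p) ∘ w == 0) = (p ∘ w == w).
  by rewrite jmulDl jmulNl jmul1l subr_eq0 eq_sym.
pose U := lker (linfun (jmul (jone - p))); pose V := lker (linfun (jmul p)).
have UP w : (w \in U) = (p ∘ w == w) by rewrite memv_ker lfunE q1.
have VP w : (w \in V) = (p ∘ w == 0) by rewrite memv_ker lfunE.
have pck k : p ∘ c k = if P k then c k else 0 by exact: frame_sub_mul.
have [Pj|Pj] := boolP (P j).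
  by move=> ij; case/asboolP: Pj => // ij'; rewrite ij' eqxx in ij.
case: simpE; exists U, V; split.
- split.
    move=> x y; rewrite !UP => /eqP px /eqP py; apply/eqP.
    by rewrite -[RHS]scale1r; apply: peirce1M => //; rewrite scale1r.
  apply/eqP => U0; have : c i \in U by rewrite UP pck ifT//; apply/asboolP; left.
  by rewrite U0 memv0 => /eqP ci0; case: (pc i) => _ /eqP.
- split.
    move=> x y; rewrite !VP => /eqP px /eqP py; apply/eqP.
    by rewrite -[RHS](scale0r (x ∘ y)); apply: peirce0M => //; rewrite scale0r.
  apply/eqP => V0; have : c j \in V by rewrite VP pck (negPf Pj).
  by rewrite V0 memv0 => /eqP cj0; case: (pc j) => _ /eqP.
- apply/eqP; rewrite eqEsubv subvf/=; apply/subvP => w _.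
  rewrite -[w](subrK (p ∘ w)) addrC memv_add//.
    rewrite UP; have := pqw w; rewrite jmulDl jmulDr jmulNl jmulNr jmul1l.
    by move=> /eqP; rewrite subr_eq0 eq_sym.
  by rewrite VP; have := pqw w; rewrite jmulDl jmulNl jmul1l => ->.
- apply/eqP; rewrite -subv0; apply/subvP => w.
  rewrite memv_cap UP VP memv0 => /andP[/eqP pw /eqP pw0].
  by rewrite -pw pw0.
- by move=> x y; rewrite UP VP => /eqP px /eqP py; exact: peirce10 pp px py.
Qed.

End PrimitiveIdempotents.

(** * Consequences of strict complementarity, and its existence on the cone *)

Section StrictComplement.
Variables (R : realType) (E : ejaType R).
Implicit Types (x y z w c lambda : E).

Lemma strict_complement_orth y lambda n (c : 'I_n -> E) (u : 'I_n -> R) i :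
  strict_complement lambda y -> jordan_frame c -> y = \sum_(j < n) u j *: c j ->
  u i != 0 -> c i ∘ lambda = 0.
Proof.
move=> [yl pos] fc yE ui; have [pc orth _] := fc.
have cc k : jidempotent (c k) by case: (pc k).
have cl k : u k != 0 -> ⟨c k, lambda⟩ = 0.
  move=> uk; have /eqP : u k * ⟨c k, lambda⟩ = 0.
    by rewrite -jipZl -(frame_mul fc) -yE jip_jmul yl jip0r.
  by rewrite mulf_eq0 (negPf uk) => /eqP.
have ycomm k z : y ∘ (c k ∘ z) = c k ∘ (y ∘ z).
  rewrite yE !jmul_suml jmul_sumr; apply: eq_bigr => l _.
  rewrite !jmulZl jmulZr; congr (_ *: _).
  by have [->//|lk] := eqVneq l k; apply: orth_commute => //; exact: orth.
have v0 j : i != j -> c i ∘ (c j ∘ lambda) = 0.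
  move=> ij; set v := _ ∘ _; apply/eqP/negPn/negP => v0.
  have vl : peirce_link (c i) (c j) v by apply: peirce_link_jmul => //; exact: orth.
  have yv : y ∘ v = 0 by rewrite /v !ycomm yl !jmul0r.
  have uij : u i + u j = 0.
    have : y ∘ v = (2^-1 * (u i + u j)) *: v.
      rewrite yE jmul_suml (bigD1 i)//= (bigD1 j) 1?eq_sym//= big1 ?addr0.
        by rewrite !jmulZl; case: vl => -> ->; clear; jlin.
      move=> k /andP[ki kj]; rewrite jmulZl (@peirce_link_orth _ _ (c i) (c j)) ?scaler0//.
      - exact: orth.
      - by rewrite orth// eq_sym.
      - by rewrite orth// eq_sym.
    rewrite yv => /esym/eqP; rewrite scaler_eq0 (negPf v0) orbF mulf_eq0.
    by rewrite invr_eq0 pnatr_eq0 => /eqP.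
  (* Needed so that [c j], like [c i], is orthogonal to [lambda]. *)
  have uj : u j != 0.
    by apply: contra_neq ui => uj; rewrite uj addr0 in uij.
  have [s [t [vv _]]] := peirce_link_sq (pc i) (pc j) (orth _ _ ij) vl.
  by have := pos v yv v0; rewrite vv jipDl !jipZl !cl// !mulr0 addr0 ltxx.
(* With all off-diagonal parts gone, [c i ∘ lambda] is a multiple of [c i]; the coefficient vanishes
   because [⟨c i, lambda⟩ = 0]. *)
have cci : c i ∘ (c i ∘ lambda) = c i ∘ lambda.
  rewrite -[RHS](frame_sum_mul fc) (bigD1 i)//= big1 ?addr0// => j ji.
  by rewrite orth_commute// ?v0// 1?eq_sym// orth.
have [t ct] := primitive_peirce1 (pc i) cci.
have := cl _ ui; rewrite -[X in ⟨X, _⟩](cc i) jip_jmul ct jipZr => /eqP.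
rewrite mulf_eq0 jip_eq0; case: (pc i) => _ /negPf -> _; rewrite orbF => /eqP ->.
by rewrite scale0r.
Qed.

(** The first conclusion allows strictness to be applied at the [d k], giving the signs of the
    eigenvalues of [lambda]; the second yields the rank count. *)
Lemma strict_complement_supports y lambda m n (c : 'I_m -> E) (u : 'I_m -> R)
    (d : 'I_n -> E) (v : 'I_n -> R) : strict_complement lambda y ->
  jordan_frame c -> y = \sum_(i < m) u i *: c i ->
  jordan_frame d -> lambda = \sum_(k < n) v k *: d k ->
  (forall k, v k != 0 -> y ∘ d k = 0) /\
  \sum_(i < m | u i != 0) c i + \sum_(k < n | v k != 0) d k = jone.
Proof.
move=> sc fc yE fd lE; have [yl pos] := sc.
set p := \sum_(i < m | _) _; set q := \sum_(k < n | _) _.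
have pp : jidempotent p by exact: frame_sub_idem.
have qq : jidempotent q by exact: frame_sub_idem.
have py : p ∘ y = y.
  rewrite yE jmul_sumr; apply: eq_bigr => i _.
  rewrite jmulZr (frame_sub_mul fc (fun i => u i != 0)).
  by case: eqVneq => //= ->; rewrite !scale0r.
have ql : q ∘ lambda = lambda.
  rewrite lE jmul_sumr; apply: eq_bigr => i _.
  rewrite jmulZr (frame_sub_mul fd (fun i => v i != 0)).
  by case: eqVneq => //= ->; rewrite !scale0r.
have pl : p ∘ lambda = 0.
  by rewrite jmul_suml big1// => i ui; exact: strict_complement_orth sc fc yE ui.
have pd k : v k != 0 -> p ∘ d k = 0.
  by move=> vk; apply: (frame_supp_orth fd (u := v)) => //; rewrite -lE.
have yd k : v k != 0 -> y ∘ d k = 0 by move=> vk; apply: (peirce10 pp) => //; exact: pd.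
split=> //; have pq : p ∘ q = 0 by rewrite jmul_sumr big1.
pose f := jone - (p + q).
have ff : jidempotent f by apply: idem_one_minus; exact: idemD.
have yf : y ∘ f = 0.
  have yq : y ∘ q = 0 by rewrite jmul_sumr big1.
  by rewrite jmulDr jmulNr jmulDr jmul1r yq addr0 jmulC py subrr.
have fl : f ∘ lambda = 0.
  by rewrite jmulDl jmulNl jmulDl jmul1l pl ql add0r subrr.
apply/eqP; rewrite eq_sym -subr_eq0 -/f; apply/negPn/negP => f0.
by have := pos f yf f0; rewrite jip_jmul fl jip0r ltxx.
Qed.

(** Whichever spectrum [jeigenvalues] selects for [c], a nonzero eigenvalue is 1 because [c] is
    idempotent, and its frame member is then [c] by primitivity. So [c] equals its trace times
    [c]. *)
Lemma trace_primitive c : trace_inner_product E -> jprimitive c -> ⟨jone, c⟩ = 1.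
Proof.
move=> htr pc; rewrite htr jmul1l /jtrace.
have [d fd cE] := jeigenvaluesP c; set s := jeigenvalues c in d fd cE *.
have [cc c0 _] := pc.
have dc (i : 'I_(size s)) : s`_i *: d i = s`_i *: c.
  have [->|si] := eqVneq s`_i 0; first by rewrite !scale0r.
  congr (_ *: _); case: fd (fd) => /(_ i)[dd d0 _] _ _ fd.
  have : s`_i ^+ 2 *: d i = s`_i *: d i.
    rewrite -(frame_mul fd (fun i => s`_i ^+ 2)) -(frame_sq fd (fun i => s`_i)).
    by rewrite -cE cc cE (frame_mul fd (fun i => s`_i)).
  move=> /eqP; rewrite -subr_eq0 -scalerBl scaler_eq0 (negPf d0) orbF.
  rewrite expr2 -{3}[s`_i]mulr1 -mulrBr mulf_eq0 (negPf si) subr_eq0 => /eqP s1.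
  apply: primitive_eq => //.
  by rewrite cE jmulC (frame_mul fd (fun i => s`_i)) s1 scale1r.
have : c = (\sum_(a <- s) a) *: c.
  rewrite (big_nth 0) big_mkord scaler_suml {1}cE.
  by apply: eq_bigr => i _; exact: dc.
move=> /eqP; rewrite -{1}[c]scale1r -subr_eq0 -scalerBl scaler_eq0 (negPf c0) orbF.
by rewrite subr_eq0 => /eqP.
Qed.

(** Pairing with [jone] counts frame members whatever the frame, which makes cardinalities taken in
    independently chosen frames comparable. *)
Lemma trace_frame_sub n (c : 'I_n -> E) (P : pred 'I_n) :
  trace_inner_product E -> jordan_frame c ->
  ⟨jone, \sum_(i < n | P i) c i⟩ = (\sum_(i < n | P i) 1)%N%:R.
Proof.
move=> htr [pc _ _]; rewrite jip_sumr natr_sum; apply: eq_bigr => i _.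
exact: trace_primitive.
Qed.

Lemma jalg_rank_trace : trace_inner_product E -> ⟨jone : E, jone⟩ = (jalg_rank E)%:R.
Proof.
move=> htr; have [c fc] := jalg_rankP E; have [_ _ c1] := fc.
by rewrite -{2}c1 (trace_frame_sub xpredT htr fc) sum1_card card_ord.
Qed.

Lemma count_nth_ord (T : Type) (x0 : T) (a : pred T) (s : seq T) :
  count a s = (\sum_(i < size s | a (nth x0 s i)) 1)%N.
Proof. by rewrite -sum1_count (big_nth x0) big_mkord. Qed.

Lemma strict_complement_rank y lambda : trace_inner_product E ->
  strict_complement lambda y -> (jrank y + jrank lambda)%N = jalg_rank E.
Proof.
move=> htr sc; apply/eqP; rewrite -(eqr_nat R) natrD -jalg_rank_trace//.
have [c fc yE] := jeigenvaluesP y; have [d fd lE] := jeigenvaluesP lambda.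
rewrite /jrank !(count_nth_ord 0) -(trace_frame_sub _ htr fc) -(trace_frame_sub _ htr fd).
by rewrite -jipDr (strict_complement_supports sc fc yE fd lE).2.
Qed.

Lemma strict_complement_cone y lambda :
  strict_complement lambda y -> cone_of_squares E lambda.
Proof.
move=> sc; have [m [c [u [fc yE]]]] := spectral_frame y.
have [n [d [v [fd lE]]]] := spectral_frame lambda.
have [yd _] := strict_complement_supports sc fc yE fd lE.
have v_ge0 k : 0 <= v k.
  have [->//|vk] := eqVneq (v k) 0; case: (fd) => /(_ k)[dd d0 _] _ _.
  have := sc.2 _ (yd _ vk) d0; rewrite jip_jmul lE (frame_mul fd) jipZr.
  by rewrite pmulr_lgt0 ?jip_gt0// => /ltW.
exists (\sum_(k < n) Num.sqrt (v k) *: d k) => //; rewrite frame_sq// lE.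
by apply: eq_bigr => k _; rewrite sqr_sqrtr.
Qed.

(** For [lambda] the square of z, take [y] to be the sum of the frame members on which z has
    eigenvalue 0. If [y ∘ w = 0] and the sum of the nonnegative [u i ^+ 2 * ⟨c i ∘ w, w⟩] vanishes,
    then every remaining [c i ∘ w] is 0 by [idem_mul_le], and so is [w]. *)
Lemma cone_strict_complement lambda :
  cone_of_squares E lambda -> exists y, strict_complement lambda y.
Proof.
move=> [z _ <-]; have [n [c [u [fc ->]]]] := spectral_frame z.
rewrite (frame_sq fc); have cc i : jidempotent (c i) by case: fc => /(_ i)[].
pose y := \sum_(i < n | u i == 0) c i; exists y; split.
  rewrite jmul_sumr big1// => i _; rewrite jmulZr (frame_sub_mul fc (fun i => u i == 0)).
  by case: eqP => [->|_]; rewrite ?expr0n ?scale0r ?scaler0.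
move=> w yw w0.
have uw_ge0 i : 0 <= u i ^+ 2 * ⟨c i ∘ w, w⟩.
  rewrite mulr_ge0 ?sqr_ge0//; apply: le_trans (idem_mul_le w (cc i)); exact: jip_ge0.
have -> : ⟨w ∘ w, \sum_(i < n) u i ^+ 2 *: c i⟩ = \sum_(i < n) u i ^+ 2 * ⟨c i ∘ w, w⟩.
  by rewrite jip_sumr; apply: eq_bigr => i _; rewrite jipZr jipC -jip_jmul.
rewrite lt_def sumr_ge0 ?andbT//; apply: contra_neqN w0 => /eqP/psumr_eq0P h.
rewrite -(frame_sum_mul fc w) (bigID (fun i => u i == 0))/= -jmul_suml -/y yw add0r.
apply: big1 => i ui; have /eqP := h (fun i _ => uw_ge0 i) i isT.
rewrite mulf_eq0 sqrf_eq0 (negPf ui) => /eqP cw; apply/eqP.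
by rewrite -jip_eq0 eq_le jip_ge0 andbT -cw idem_mul_le.
Qed.

End StrictComplement.

Theorem theorem3p3 (R : realType) (E : ejaType R)
    (htr : trace_inner_product E)
    (l : nat) (B : 'I_l -> ejsub E) (hB : simple_decomposition B)
    (lambda : E) :
  (cone_of_squares E lambda <-> exists y : E, strict_complement lambda y) /\
  (forall y : E, strict_complement lambda y ->
     (jrank y)%:Z = (jalg_rank E)%:Z - (jrank lambda)%:Z /\
     (forall yB : forall i : 'I_l, ejsub_type (B i),
        y = \sum_(i < l) vsval (yB i) ->
        forall (i : 'I_l) (s s' : R),
          s \in jeigenvalues (yB i) -> s' \in jeigenvalues (yB i) ->
          s != 0 -> s' != 0 -> s + s' != 0)).
Proof.
split; first by split=> [|[y]]; [exact: cone_strict_complement|exact: strict_complement_cone].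
move=> y sc; split.
  by rewrite -(strict_complement_rank htr sc) PoszD addrK.
move=> yB yE i s s' hs hs' s0 s0'; apply/eqP => ss.
have [_ _ orthB simpB] := hB.
have [d fd yBE] := jeigenvaluesP (yB i).
set t := jeigenvalues (yB i) in hs hs' d fd yBE.
have /nthP-/(_ 0)[k kt tk] := hs; have /nthP-/(_ 0)[k' kt' tl] := hs'.
(* Components of [y] in the other blocks annihilate [B i], so [y] acts there as [yB i]. *)
have yw (w : ejsub_type (B i)) : y ∘ vsval w = vsval (yB i ∘ w).
  rewrite yE jmul_suml (bigD1 i)//= big1 ?addr0// => j ji.
  by have [] := orthB j i ji (vsval (yB j)) (vsval w) (subvsP _) (subvsP _).
have valZ (a : R) (x : ejsub_type (B i)) : vsval (a *: x) = a *: vsval x by exact: linearZ.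
have valD (x x' : ejsub_type (B i)) : vsval (x + x') = vsval x + vsval x' by exact: linearD.
have dl (j : 'I_(size t)) : t`_j != 0 -> ⟨vsval (d j), lambda⟩ = 0.
  move=> tj; have /eqP : t`_j * ⟨vsval (d j), lambda⟩ = 0.
    have := frame_mul fd (fun j => t`_j) j; rewrite -yBE jmulC => /(congr1 vsval).
    rewrite -yw valZ -jipZl => <-.
    by rewrite jmulC jip_jmul sc.1 jip0r.
  by rewrite mulf_eq0 (negPf tj) => /eqP.
pose K := Ordinal kt; pose L := Ordinal kt'.
(* Opposite nonzero eigenvalues are different, so they sit at different positions of the frame. *)
have KL : K != L.
  apply: contra_neq s0 => KL; have {}KL : k = k' by case: KL.
  by move: ss; rewrite -tk -tl KL; lra.
have [w w0 hw] := simple_peirce_link (simpB i) fd KL.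
have [pd orth _] := fd.
have [a [b [ww _]]] := peirce_link_sq (pd K) (pd L) (orth _ _ KL) hw.
have yBw : yB i ∘ w = 0.
  rewrite yBE jmul_suml (bigD1 K)//= (bigD1 L) 1?eq_sym//= big1 ?addr0.
    rewrite !jmulZl; case: hw => -> ->; rewrite !scalerA -scalerDl -mulrDl tk tl ss.
    by rewrite mul0r scale0r.
  move=> j /andP[jK jL]; rewrite jmulZl (@peirce_link_orth _ _ (d K) (d L)) ?scaler0//.
  - by case: (pd K).
  - by case: (pd L).
  - exact: orth.
  - by rewrite orth// eq_sym.
  - by rewrite orth// eq_sym.
have := sc.2 (vsval w); rewrite yw yBw linear0 => /(_ erefl).
have -> : vsval w ∘ vsval w = vsval (w ∘ w) by [].
rewrite ww valD !valZ jipDl !jipZl !dl/= ?tk ?tl// !mulr0 addr0 ltxx.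
move=> h; suff: false by []; apply: h.
by apply: contra_neq w0 => w0; exact: val_inj.
Qed.
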